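(* Let $\xi$ be a random vector in $\mathbb{R}^d$ and let $T\subset\mathbb{R}^d$ be a closed, convex set containing the origin. Then for every $\sigma>0$, $$w_\xi(T)=\mathbb{E}\Big[\sup_{t\in T}\Big\{\langle t,\xi\rangle-\frac{\|t\|_2^2}{2\sigma}\Big\}\Big]+\frac12\int_\sigma^\infty\mathbb{E}\|\Pi_{T/\nu}(\xi)\|_2^2\,d\nu .$$ In particular, $$w_\xi(T)=\frac12\int_0^\infty\mathbb{E}\|\Pi_{T/\nu}(\xi)\|_2^2\,d\nu .$$
   Context: For a random vector $\xi\in\mathbb{R}^d$ and a nonempty set $S\subset\mathbb{R}^d$, $w_\xi(S)=\mathbb{E}\big[\sup_{x\in S}\langle\xi,x\rangle\big]$ (in $[0,+\infty]$ when $0\in S$). For a nonempty closed convex set $S\subset\mathbb{R}^d$, $\Pi_S(x)=\operatorname*{arg\,min}_{t\in S}\|x-t\|_2^2$ is the Euclidean metric projection onto $S$, and $T/\nu=\{t/\nu:t\in T\}$. The identities are understood in $[0,+\infty]$. *)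

(* Defs.v *)
From HB Require Import structures.
From mathcomp Require Import all_boot all_order all_algebra.
From mathcomp Require Import all_classical all_reals all_analysis.
Set Implicit Arguments.
Unset Strict Implicit.
Unset Printing Implicit Defensive.
Import Order.TTheory GRing.Theory Num.Theory.
Import numFieldNormedType.Exports.
Local Open Scope classical_set_scope.
Local Open Scope ring_scope.

(* 'rV[R]_n with its Borel sigma-algebra. *)
Definition borel_rV (R : realType) (n : nat) :=
  g_sigma_algebraType (@open 'rV[R]_n).

Definition dotp (R : realType) (n : nat) (x y : 'rV[R]_n) : R :=
  \sum_(i < n) x ord0 i * y ord0 i.

(* The library norm `|x| on 'rV[R]_n is the sup norm. *)
Definition norm2 (R : realType) (n : nat) (x : 'rV[R]_n) : R :=
  Num.sqrt (dotp x x).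

(* The values are extended reals, and an integral against P may be +oo. *)
Definition width (dO : measure_display) (Omega : measurableType dO)
    (R : realType) (P : probability Omega R) (n : nat)
    (xi : Omega -> 'rV[R]_n) (S : set 'rV[R]_n) : \bar R :=
  (\int[P]_w ereal_sup [set (dotp (xi w) x)%:E | x in S])%E.

(* The set of minimizers is a singleton when S is nonempty, closed and convex;
   0 is a junk value used only when there is no minimizer. *)
Definition metric_proj (R : realType) (n : nat) (S : set 'rV[R]_n) (x : 'rV[R]_n) :
    'rV[R]_n :=
  xget 0 [set p | S p /\
    forall t, S t -> norm2 (x - p) ^+ 2 <= norm2 (x - t) ^+ 2].

Definition setdiv (R : realType) (n : nat) (T : set 'rV[R]_n) (nu : R) :
    set 'rV[R]_n :=
  [set nu^-1 *: t | t in T].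

(* Main.v *)
Require Import Defs.
From HB Require Import structures.
From mathcomp Require Import all_boot all_order all_algebra.
From mathcomp Require Import all_classical all_reals all_analysis.
From mathcomp Require Import measurable_realfun ring lra.
Set Implicit Arguments.
Unset Strict Implicit.
Unset Printing Implicit Defensive.
Import Order.TTheory GRing.Theory Num.Theory.
Import numFieldNormedType.Exports.
Local Open Scope classical_set_scope.
Local Open Scope ring_scope.

(* Fix x and put p(nu) = Pi_T(nu x), so that Pi_{T/nu}(x) = p(nu)/nu. Completing
   the square, p(nu) maximizes <t,x> - |t|^2/(2 nu) over T; let F(nu) be the
   maximum. The projection is nonexpansive, so p is continuous, and the envelope
   argument gives F'(nu) = |p(nu)|^2/(2 nu^2). Moreover 0 <= F(nu) <= nu |x|^2/2,
   so F tends to 0 at 0, and F increases to sup_T <t,x> at infinity. Integrating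
   F' over ]0, sigma] and over ]0, +oo[ gives both identities for fixed x, and
   Tonelli's theorem averages them over x = xi(w). *)

(** * The Euclidean inner product on row vectors *)

Section dot_product.
Context {R : realType} {n : nat}.
Implicit Types x y z : 'rV[R]_n.

Lemma dotpC x y : dotp x y = dotp y x.
Proof. by apply: eq_bigr => i _; rewrite mulrC. Qed.

Lemma dotpDl x y z : dotp (x + y) z = dotp x z + dotp y z.
Proof. by rewrite -big_split; apply: eq_bigr => i _; rewrite mxE mulrDl. Qed.

Lemma dotpZl a x z : dotp (a *: x) z = a * dotp x z.
Proof. by rewrite /dotp mulr_sumr; apply: eq_bigr => i _; rewrite mxE mulrA. Qed.

Lemma dotpNl x z : dotp (- x) z = - dotp x z.
Proof. by rewrite -scaleN1r dotpZl mulN1r. Qed.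

Lemma dotpDr x y z : dotp z (x + y) = dotp z x + dotp z y.
Proof. by rewrite dotpC dotpDl ![dotp _ z]dotpC. Qed.

Lemma dotpZr a x z : dotp z (a *: x) = a * dotp z x.
Proof. by rewrite dotpC dotpZl dotpC. Qed.

Lemma dotpNr x z : dotp z (- x) = - dotp z x.
Proof. by rewrite dotpC dotpNl dotpC. Qed.

Definition dotpE := (dotpDl, dotpDr, dotpNl, dotpNr, dotpZl, dotpZr).

Lemma dotp0l x : dotp 0 x = 0.
Proof. by rewrite /dotp big1// => i _; rewrite mxE mul0r. Qed.

Lemma dotp_ge0 x : 0 <= dotp x x.
Proof. by apply: sumr_ge0 => i _; rewrite -expr2 sqr_ge0. Qed.

Lemma sqr_coord_le_dotp x i : x ord0 i ^+ 2 <= dotp x x.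
Proof.
rewrite /dotp (bigD1 i)//= -expr2 lerDl.
by apply: sumr_ge0 => j _; rewrite -expr2 sqr_ge0.
Qed.

Lemma dotp_eq0 x : dotp x x <= 0 -> x = 0.
Proof.
move=> x0; apply/rowP => i; rewrite mxE.
have : x ord0 i ^+ 2 <= 0 by apply: le_trans x0; exact: sqr_coord_le_dotp.
by move=> h; apply/eqP; rewrite -sqrf_eq0 eq_le h sqr_ge0.
Qed.

Lemma norm2_sqr x : norm2 x ^+ 2 = dotp x x.
Proof. by rewrite sqr_sqrtr// dotp_ge0. Qed.

Lemma dotp_continuous (E : topologicalType) (f g : E -> 'rV[R]_n) :
  (forall i, continuous (fun x : E => f x ord0 i)) ->
  (forall i, continuous (fun x : E => g x ord0 i)) ->
  continuous (fun x : E => dotp (f x) (g x)).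
Proof.
move=> cf cg; rewrite /dotp; apply: continuous_big => [|i _ x].
  exact: add_continuous.
by apply: continuousM; [exact: cf|exact: cg].
Qed.

Lemma dotp_sub_continuous x : continuous (fun t : 'rV[R]_n => dotp (x - t) (x - t)).
Proof.
have c i : continuous (fun t : 'rV[R]_n => (x - t) ord0 i).
  move=> t; rewrite (_ : (fun _ => _) = (fun t : 'rV[R]_n => x ord0 i - t ord0 i)).
    by apply: (@cvgB R R^o _ (nbhs t)); [exact: cvg_cst|exact: coord_continuous].
  by apply/funext => u; rewrite !mxE.
exact: dotp_continuous.
Qed.

End dot_product.

(** * Metric projection onto a closed convex set containing 0 *)

Section projection.
Context {R : realType} {n : nat} (T : set 'rV[R]_n).
Implicit Types x y p q t : 'rV[R]_n.

Definition closest x p :=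
  T p /\ forall t, T t -> norm2 (x - p) ^+ 2 <= norm2 (x - t) ^+ 2.

Hypothesis cT : closed T.
Hypothesis convT : convex_set (T : set (convex_lmodType 'rV[R]_n)).
Hypothesis T0 : T 0.

(** Only the points of T at distance at most |x| from x can compete, since 0 lies in T. They form a
    nonempty compact set, on which the continuous squared distance attains its minimum. *)
Lemma closest_exists x : exists p, closest x p.
Proof.
pose B := T `&` [set t | dotp (x - t) (x - t) <= dotp x x].
have ct := @dotp_sub_continuous R n x.
have clB : closed B.
  apply: closedI => //.
  exact: (closed_comp (fun t _ => ct t) (@closed_le _ (dotp x x))).
have bB : bounded_set B.
  exists (`|x| + Num.sqrt (dotp x x)); split; first exact: num_real.
  move=> M xM t [_ /= tB].
  (* Here t = x - (x - t), and the sup norm of x - t is at most its Euclidean norm. *)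
  rewrite -(subKr x t); apply/ltW; apply: le_lt_trans xM.
  apply: (le_trans (ler_normB _ _)); rewrite lerD2l.
  rewrite [leLHS]mx_normrE (bigmax_le _ _)//= ?sqrtr_ge0// => -[i j] _ /=.
  rewrite (ord1 i) -sqrtr_sqr ler_wsqrtr//.
  exact: le_trans (sqr_coord_le_dotp _ _) tB.
have B0 : B !=set0 by exists 0; split => //=; rewrite subr0.
have [p pB pmin] := compact_EVT_min B0 (bounded_closed_compact bB clB)
  (continuous_subspaceT ct).
move: pB; rewrite inE => -[Tp pB]; exists p; split => // t Tt.
rewrite !norm2_sqr.
have [tB|/ltW tB] := leP (dotp (x - t) (x - t)) (dotp x x).
  by apply: pmin; rewrite inE.
exact: le_trans tB.
Qed.

(** Moving from p towards t by a fraction l stays in T and cannot decrease the distance to x.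
    Expanding the square gives 2a <= l b for every l in ]0, 1], which excludes a > 0. *)
Lemma closest_variational x p : closest x p ->
  forall t, T t -> dotp (x - p) (t - p) <= 0.
Proof.
move=> [Tp pmin] t Tt; set a := dotp _ _; set b := dotp (t - p) (t - p).
have b0 : 0 <= b by exact: dotp_ge0.
have key (l : R) : 0 < l -> l <= 1 -> 2 * a <= l * b.
  move=> l0 l1.
  have li : Itv.spec (@Itv.num_sem R) (Itv.Real `[0%Z, 1%Z]) l.
    by apply/andP; split; rewrite ?num_real//= in_itv/= ltW.
  pose L : {i01 R} := Itv.mk li.
  have : T (l *: t + (1 - l) *: p).
    by have := convT L (mem_set Tt) (mem_set Tp); rewrite inE.
  move=> /pmin; rewrite !norm2_sqr.
  have -> : x - (l *: t + (1 - l) *: p) = (x - p) - l *: (t - p).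
    by apply/rowP => i; rewrite !mxE; ring.
  have -> : dotp (x - p - l *: (t - p)) (x - p - l *: (t - p)) =
    dotp (x - p) (x - p) - 2 * l * a + l ^+ 2 * b.
    rewrite /a /b; move: (x - p) (t - p) => u v.
    by rewrite !dotpE (dotpC v u); ring.
  move=> h; have : 0 <= l * (l * b - 2 * a) by lra.
  by rewrite pmulr_rge0// subr_ge0.
rewrite leNgt; apply/negP => a0.
(* A well-chosen l replaces the limit l -> 0: if b <= a, then l = 1 gives 2a <= a; otherwise l = a /
   b is admissible and gives the same contradiction. *)
have [ba|ab] := leP b a.
  by have := key 1 ltr01 (lexx _); lra.
have b_gt0 : 0 < b by exact: lt_trans ab.
have := key (a / b) (divr_gt0 a0 b_gt0).
rewrite ler_pdivrMr// mul1r => /(_ (ltW ab)).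
by rewrite divfK ?gt_eqF//; lra.
Qed.

(** The variational inequalities at p and at q add up to |p - q|^2 <= <x - y, p - q>. Expanding |(x
    - y) - (p - q)|^2 >= 0 then finishes without Cauchy-Schwarz. *)
Lemma closest_nonexpansive x y p q : closest x p -> closest y q ->
  dotp (p - q) (p - q) <= dotp (x - y) (x - y).
Proof.
move=> xp yq.
have h1 := closest_variational xp yq.1; have h2 := closest_variational yq xp.1.
have := dotp_ge0 ((x - y) - (p - q)).
move: h1 h2; rewrite !dotpE.
rewrite ?(dotpC y x) ?(dotpC p x) ?(dotpC q x) ?(dotpC p y) ?(dotpC q y) ?(dotpC q p).
lra.
Qed.

Lemma closest_unique x p q : closest x p -> closest x q -> p = q.
Proof.
move=> xp xq; apply/eqP; rewrite -subr_eq0; apply/eqP/dotp_eq0.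
by apply: le_trans (closest_nonexpansive xp xq) _; rewrite subrr dotp0l.
Qed.

Lemma metric_projP x : closest x (metric_proj T x).
Proof. exact: xgetPex (closest_exists x). Qed.

Lemma metric_proj_in x : T (metric_proj T x).
Proof. by case: (metric_projP x). Qed.

Lemma metric_proj_coord_continuous i :
  continuous (fun x => metric_proj T x ord0 i).
Proof.
move=> x; apply: (@cvgrPdist_le _ R^o _ (nbhs x) (nbhs_filter x) _ _).2 => e e0.
have ct := @dotp_sub_continuous R n x.
have := (@cvgrPdist_le _ R^o _ (nbhs x) (nbhs_filter x) _ _).1 (ct x) (e ^+ 2).
rewrite subrr dotp0l exprn_gt0// => /(_ isT); apply: filterS => y.
rewrite sub0r normrN ger0_norm ?dotp_ge0// => xye.
suff : `|metric_proj T x ord0 i - metric_proj T y ord0 i| ^+ 2 <= e ^+ 2.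
  by rewrite ler_sqr ?nnegrE ?(ltW e0).
rewrite real_normK ?num_real//; apply: le_trans xye.
apply: le_trans (closest_nonexpansive (metric_projP x) (metric_projP y)).
by have := sqr_coord_le_dotp (metric_proj T x - metric_proj T y) i; rewrite !mxE.
Qed.

(** Since |nu x - t| = nu |x - t / nu|, scaling by 1 / nu carries minimizers over T to minimizers
    over T / nu. *)
Lemma metric_proj_setdiv (nu : R) x : 0 < nu ->
  metric_proj (setdiv T nu) x = nu^-1 *: metric_proj T (nu *: x).
Proof.
move=> nu0.
have nuK (u : 'rV[R]_n) : nu *: (nu^-1 *: u) = u.
  by rewrite scalerA mulfV ?scale1r// gt_eqF.
have dist t : norm2 (nu *: x - t) ^+ 2 = nu ^+ 2 * norm2 (x - nu^-1 *: t) ^+ 2.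
  have {1}-> : nu *: x - t = nu *: (x - nu^-1 *: t) by rewrite scalerBr nuK.
  by rewrite !norm2_sqr dotpZl dotpZr; ring.
have nu20 : 0 < nu ^+ 2 by rewrite exprn_gt0.
(* Either a minimizer q = t / nu was chosen, and uniqueness identifies t; or none exists, which the
   scaled projection refutes, so the junk value 0 never occurs. *)
rewrite {1}/metric_proj; case: xgetP => [q _|/(_ (nu^-1 *: metric_proj T (nu *: x)))[]] /=.
  move=> [[t Tt <-{q}] qmin]; congr (_ *: _).
  apply: closest_unique (metric_projP (nu *: x)); split => // s Ts.
  by rewrite !dist ler_pM2l//; apply: qmin; exists s.
have [Tp pmin] := metric_projP (nu *: x).
split; first by exists (metric_proj T (nu *: x)).
by move=> _ [s Ts <-]; have := pmin _ Ts; rewrite !dist ler_pM2l.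
Qed.

End projection.

(** * The penalized maximum as a function of nu, and its derivative *)

Section envelope.
Context {R : realType} {n : nat} (T : set 'rV[R]_n).
Implicit Types (x t : 'rV[R]_n) (mu nu : R).

(** Putting the scaling in the argument keeps T fixed, so regularity in nu is inherited from a
    single projection map. *)
Definition sqr_proj nu x : R :=
  dotp (metric_proj T (nu *: x)) (metric_proj T (nu *: x)).

(** The penalized objective evaluated at its maximizer, hence a real number; [envelope_sup]
    identifies it with the supremum for nu > 0. *)
Definition envelope nu x : R :=
  dotp (metric_proj T (nu *: x)) x - sqr_proj nu x / (2 * nu).

Hypothesis cT : closed T.
Hypothesis convT : convex_set (T : set (convex_lmodType 'rV[R]_n)).
Hypothesis T0 : T 0.

Lemma sqr_proj_ge0 nu x : 0 <= sqr_proj nu x.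
Proof. exact: dotp_ge0. Qed.

(** Completing the square: |nu x - t|^2 is nu^2 |x|^2 minus 2 nu times the objective at t, so the
    closest point maximizes the objective. *)
Lemma envelope_max nu x t : 0 < nu -> T t ->
  dotp t x - dotp t t / (2 * nu) <= envelope nu x.
Proof.
move=> nu0 Tt; have [_ /(_ t Tt)] := metric_projP cT T0 (nu *: x).
rewrite /envelope /sqr_proj !norm2_sqr; move: (metric_proj _ _) => p.
rewrite !dotpE (dotpC x p) (dotpC x t) -subr_ge0 => h.
have -> : dotp t x = 2 * nu * dotp t x / (2 * nu) by field; rewrite gt_eqF.
have -> : dotp p x = 2 * nu * dotp p x / (2 * nu) by field; rewrite gt_eqF.
rewrite -!mulrBl ler_pM2r ?invr_gt0 ?mulr_gt0// -subr_ge0.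
lra.
Qed.

Lemma envelope_sup nu x : 0 < nu ->
  ereal_sup [set (dotp t x - norm2 t ^+ 2 / (2 * nu))%:E | t in T] =
  (envelope nu x)%:E.
Proof.
move=> nu0; apply/eqP; rewrite eq_le; apply/andP; split.
  apply: ge_ereal_sup => _ [t Tt <-]; rewrite lee_fin norm2_sqr.
  exact: envelope_max.
apply: ereal_sup_ubound; exists (metric_proj T (nu *: x)).
  exact: metric_proj_in.
by rewrite norm2_sqr.
Qed.

(* The maximizer for mu is a competitor for nu. Exchanging mu and nu gives the
   matching upper bound, hence both the monotonicity of sqr_proj and the
   derivative of the envelope. *)
Lemma envelope_sub mu nu x : 0 < mu -> 0 < nu ->
  sqr_proj mu x / 2 * (mu^-1 - nu^-1) <= envelope nu x - envelope mu x.
Proof.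
move=> mu0 nu0; have := envelope_max x nu0 (metric_proj_in cT T0 (mu *: x)).
rewrite [envelope mu x]/envelope -/(sqr_proj mu x) !invfM => h; lra.
Qed.

Lemma sqr_proj_ndecr mu nu x : 0 < mu -> mu <= nu -> sqr_proj mu x <= sqr_proj nu x.
Proof.
move=> mu0; rewrite le_eqVlt => /predU1P[->//|mn].
have nu0 : 0 < nu by exact: lt_trans mn.
have h1 := envelope_sub x mu0 nu0; have h2 := envelope_sub x nu0 mu0.
have d0 : 0 < mu^-1 - nu^-1 by rewrite subr_gt0 ltf_pV2.
rewrite -(ler_pM2r d0); lra.
Qed.

Lemma envelope_ge0 nu x : 0 < nu -> 0 <= envelope nu x.
Proof. by move=> nu0; have := envelope_max x nu0 T0; rewrite !dotp0l mul0r subr0. Qed.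

(** The gap between the two sides is |nu x - p|^2 / (2 nu), where p is the projection of nu x. The
    bound makes the envelope vanish as nu tends to 0. *)
Lemma envelope_le nu x : 0 < nu -> envelope nu x <= nu * dotp x x / 2.
Proof.
move=> nu0; rewrite /envelope /sqr_proj; move: (metric_proj _ _) => p.
have := dotp_ge0 (nu *: x - p); rewrite !dotpE (dotpC x p) => h.
rewrite -subr_ge0.
have -> : nu * dotp x x / 2 - (dotp p x - dotp p p / (2 * nu)) =
  (nu * (nu * dotp x x) + nu * - dotp p x + (- (nu * dotp p x) - - dotp p p)) / (2 * nu).
  by field; rewrite gt_eqF.
by apply: divr_ge0; [lra|rewrite mulr_ge0// ltW].
Qed.

Lemma envelope_ndecr mu nu x : 0 < mu -> mu <= nu -> envelope mu x <= envelope nu x.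
Proof.
move=> mu0 mn; have nu0 : 0 < nu by exact: lt_le_trans mn.
rewrite -subr_ge0; apply: le_trans (envelope_sub x mu0 nu0).
by rewrite mulr_ge0 ?divr_ge0 ?sqr_proj_ge0// subr_ge0 lef_pV2.
Qed.

Lemma sqr_proj_continuous nu : continuous (sqr_proj nu).
Proof.
have cp i : continuous (fun x => metric_proj T (nu *: x) ord0 i).
  move=> x; apply: (cvg_comp _ (fun y => metric_proj T y ord0 i)).
    exact: (@scaler_continuous _ _ nu x).
  exact: metric_proj_coord_continuous.
exact: dotp_continuous.
Qed.

Lemma sqr_proj_continuousl x : continuous (sqr_proj^~ x).
Proof.
have cp i : continuous (fun nu => metric_proj T (nu *: x) ord0 i).
  move=> nu; apply: (cvg_comp _ (fun y => metric_proj T y ord0 i)).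
    exact: (@scalel_continuous _ _ x nu).
  exact: metric_proj_coord_continuous.
exact: dotp_continuous.
Qed.

Lemma norm2_metric_proj_setdiv nu x : 0 < nu ->
  norm2 (metric_proj (setdiv T nu) x) ^+ 2 = sqr_proj nu x * nu^-1 ^+ 2.
Proof.
by move=> nu0; rewrite metric_proj_setdiv// norm2_sqr dotpZl dotpZr -/(sqr_proj nu x); ring.
Qed.

(** By [envelope_sub] in both directions, the difference quotient lies between K c(h) and K' c(h),
    where K and K' are [sqr_proj] at nu and nu + h. Continuity of [sqr_proj] in nu closes the
    squeeze. *)
Lemma is_derive_envelope nu x : 0 < nu ->
  is_derive nu 1 (envelope^~ x) (sqr_proj nu x * nu^-1 ^+ 2 / 2).
Proof.
move=> nu0.
(* This is (1 / nu - 1 / (h + nu)) / (2 h), with h cancelled so that the limit at 0 is visible. *)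
pose c h := (2 * nu * (h + nu))^-1.
have cvgh : h + nu @[h --> 0^'] --> nu.
  rewrite -[X in _ --> X]add0r; apply: cvg_within_filter.
  by apply: cvgD; [exact: cvg_id|exact: cvg_cst].
have cvgc : c h @[h --> 0^'] --> (2 * nu * nu)^-1.
  apply: cvgV; first by rewrite !mulf_neq0 ?gt_eqF.
  by apply: cvgM => //; exact: cvg_cst.
have cvgK : sqr_proj (h + nu) x @[h --> 0^'] --> sqr_proj nu x.
  exact: (cvg_comp _ _ cvgh (@sqr_proj_continuousl x nu)).
have cvgq : h^-1 *: (envelope (h *: 1 + nu) x - envelope nu x) @[h --> 0^'] -->
    sqr_proj nu x * nu^-1 ^+ 2 / 2.
  (* Which of K c(h) and K' c(h) is the lower bound depends on the sign of h; the symmetric error e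
     covers both cases. *)
  pose e h := `|sqr_proj (h + nu) x - sqr_proj nu x| * c h.
  have cvge : e h @[h --> 0^'] --> 0.
    have cvgd : sqr_proj (h + nu) x - sqr_proj nu x @[h --> 0^'] --> 0.
      rewrite -[X in _ --> X](subrr (sqr_proj nu x)).
      by apply: (@cvgB R R^o) => //; exact: cvg_cst.
    have := cvgM (@cvg_norm R R _ _ _ _ _ cvgd) cvgc.
    by rewrite normr0 mul0r; exact.
  have -> : sqr_proj nu x * nu^-1 ^+ 2 / 2 = sqr_proj nu x * (2 * nu * nu)^-1.
    by field; rewrite gt_eqF.
  have cvgl : sqr_proj nu x * c h @[h --> 0^'] -->
      sqr_proj nu x * (2 * nu * nu)^-1 by apply: cvgM => //; exact: cvg_cst.
  apply: (@squeeze_cvgr _ _ _ _ (fun h => sqr_proj nu x * c h - e h)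
    (fun h => sqr_proj nu x * c h + e h)); last 2 first.
  - by rewrite -[X in _ --> X]subr0; exact: cvgB.
  - by rewrite -[X in _ --> X]addr0; exact: cvgD.
  have hpos : \forall h \near 0^', 0 < h + nu.
    exact: (cvgr_gt _ cvgh).
  have hneq : \forall h \near 0^', h != 0 :> R by exact: nbhs_dnbhs_neq.
  near=> h.
  have h0 : h != 0 by near: h.
  have hnu : 0 < h + nu by near: h.
  have c0 : 0 < c h by rewrite invr_gt0 !mulr_gt0.
  have l1 := envelope_sub x nu0 hnu; have l2 := envelope_sub x hnu nu0.
  have E : nu^-1 - (h + nu)^-1 = 2 * h * c h.
    by rewrite /c; field; rewrite !gt_eqF.
  rewrite -opprB E in l2; rewrite E in l1.
  rewrite [h *: 1]mulr1 [_ *: _]mulrC /e.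
  set q := (_ / h).
  have Dq : envelope (h + nu) x - envelope nu x = q * h by rewrite /q mulfVK.
  rewrite Dq in l1; rewrite -opprB Dq in l2.
  move: l1 l2; move: (sqr_proj nu x) (sqr_proj (h + nu) x) (c h) c0 => K K' C C0 l1 l2.
  have N1 : (K' - K) * C <= `|K' - K| * C by rewrite ler_pM2r// ler_norm.
  have N2 : (K - K') * C <= `|K' - K| * C by rewrite ler_pM2r// distrC ler_norm.
  have N0 : 0 <= `|K' - K| * C by rewrite mulr_ge0// ltW.
  have [hlt|hgt|h0'] := ltgtP h 0; last by rewrite h0' eqxx in h0.
    have u1 : q <= K * C by rewrite -(ler_nM2r hlt); lra.
    have u2 : K' * C <= q by rewrite -(ler_nM2r hlt); lra.
    by apply/andP; split; lra.
  have u1 : K * C <= q by rewrite -(ler_pM2r hgt); lra.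
  have u2 : q <= K' * C by rewrite -(ler_pM2r hgt); lra.
  by apply/andP; split; lra.
apply: DeriveDef; first by apply/cvg_ex; eexists; exact: cvgq.
by apply: cvg_lim => //; exact: cvgq.
Unshelve. all: by end_near.
Qed.

End envelope.

(** * Integration in nu for a fixed vector x *)

Section radial_integral.
Context {R : realType} {n : nat} (T : set 'rV[R]_n).
Implicit Types (x t : 'rV[R]_n) (mu nu : R).
Local Notation lambda := (@lebesgue_measure R).

(** For nu > 0 this is the squared norm of the projection onto T / nu, by
    [norm2_metric_proj_setdiv]. *)
Definition density x nu := sqr_proj T nu x * nu^-1 ^+ 2.

Lemma density_ge0 x nu : 0 <= density x nu.
Proof. by rewrite mulr_ge0 ?sqr_proj_ge0 ?sqr_ge0. Qed.

Hypothesis cT : closed T.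
Hypothesis convT : convex_set (T : set (convex_lmodType 'rV[R]_n)).
Hypothesis T0 : T 0.

Let density_continuous x nu : 0 < nu -> {for nu, continuous (density x)}.
Proof.
move=> nu0; apply: (@cvgM R R); first exact: sqr_proj_continuousl.
have c : nu'^-1 @[nu' --> nu] --> nu^-1 by apply: cvgV; rewrite ?gt_eqF//; exact: cvg_id.
exact: (cvgM c c).
Qed.

Let is_derive_envelope2 x nu : 0 < nu ->
  is_derive nu 1 (fun nu => 2 * envelope T nu x) (density x nu).
Proof.
move=> nu0; have := is_derive_envelope cT convT T0 x nu0.
move=> /(@is_deriveZ R R R _ 2) h; apply: (is_derive_eq h).
by rewrite [LHS]mulrC divfK.
Qed.

Let envelope2_continuous x nu : 0 < nu ->
  {for nu, continuous (fun nu => 2 * envelope T nu x)}.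
Proof.
move=> nu0; apply: differentiable_continuous; apply/derivable1_diffP.
by case: (is_derive_envelope2 x nu0).
Qed.

Let within_density x (A : set R) : (forall nu, A nu -> 0 < nu) ->
  {within A, continuous (density x)}.
Proof.
move=> A0; apply: continuous_in_subspaceT => nu; rewrite inE => /A0.
exact: density_continuous.
Qed.

Lemma measurable_density x (A : set R) : measurable A ->
  (forall nu, A nu -> 0 < nu) -> measurable_fun A (density x).
Proof.
by move=> mA A0; apply: subspace_continuous_measurable_fun => //; exact: within_density.
Qed.

Lemma integral_density_segment x a b : 0 < a -> a < b ->
  (\int[lambda]_(nu in `[a, b]) (density x nu)%:E =
   (2 * envelope T b x)%:E - (2 * envelope T a x)%:E)%E.
Proof.
move=> a0 ab; have b0 := lt_trans a0 ab.
apply: (@continuous_FTC2 R (density x) (fun nu => 2 * envelope T nu x) a b ab) => [||nu].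
- by apply: within_density => nu /=; rewrite in_itv/= => /andP[/(lt_le_trans a0)].
- split => [nu||].
  + rewrite in_itv/= => /andP[/(lt_trans a0) nu0 _].
    by case: (is_derive_envelope2 x nu0).
  + by apply: cvg_at_right_filter; exact: envelope2_continuous.
  + by apply: cvg_at_left_filter; exact: envelope2_continuous.
- rewrite in_itv/= => /andP[/(lt_trans a0) nu0 _].
  by rewrite derive1E; case: (is_derive_envelope2 x nu0).
Qed.

(** Monotone convergence along segments [a k, b] with a k decreasing to 0; the contribution of the
    envelope at a k disappears in the limit. *)
Lemma integral_density x b : 0 < b ->
  (\int[lambda]_(nu in `]0%R, b]) (density x nu)%:E = (2 * envelope T b x)%:E)%E.
Proof.
(* The shift by 2 makes a k < b already at k = 0. *)
move=> b0; pose a k : R := b / k.+2%:R.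
have a0 k : 0 < a k by rewrite divr_gt0.
have ab k : a k < b by rewrite ltr_pdivrMr// ltr_pMr// ltr1n.
have cvga : a k @[k --> \oo] --> 0.
  rewrite -(mulr0 b); apply: (@cvgM R); first exact: cvg_cst.
  by have := @cvg_harmonic R; rewrite -(cvg_shiftS (harmonic : nat -> R^o)).
have -> : `]0%R, b]%classic = \bigcup_k `[a k, b]%classic.
  apply/seteqP; split => [nu|nu [k _]] /=; last first.
    by rewrite !in_itv/= => /andP[/(lt_le_trans (a0 k)) -> ->].
  rewrite in_itv/= => /andP[nu0 nub].
  have [k _ /(_ k (leqnn k))/= h] := cvgr_lt _ cvga _ nu0.
  by exists k => //=; rewrite in_itv/= nub ltW.
have : (\int[lambda]_(nu in `[a k, b]) (density x nu)%:E)%E @[k --> \oo] -->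
    (\int[lambda]_(nu in \bigcup_k `[a k, b]%classic) (density x nu)%:E)%E.
  apply: ge0_nondecreasing_set_cvg_integral => [j k jk|k|k|k nu _].
  - rewrite subsetEset; apply: subset_itvr; rewrite bnd_simp /a.
    by rewrite ler_pM2l// lef_pV2 ?posrE// ler_nat.
  - exact: measurable_itv.
  - apply/measurable_EFinP; apply: measurable_density; first exact: measurable_itv.
    by move=> nu /=; rewrite in_itv/= => /andP[/(lt_le_trans (a0 k))].
  - by rewrite lee_fin density_ge0.
under eq_fun do rewrite integral_density_segment//.
move=> /(cvg_lim (@ereal_hausdorff R)) <-; apply: (cvg_lim (@ereal_hausdorff R)).
under eq_fun do rewrite -EFinB; apply: cvg_EFin; first exact: nearW.
rewrite /comp/= -[X in _ --> X]subr0; apply: (@cvgB R R^o); first exact: cvg_cst.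
(* The upper bound is twice the one of [envelope_le] at a k. *)
apply: (@squeeze_cvgr _ _ _ _ (fun=> 0) (fun k => a k * dotp x x)).
- apply: nearW => k; rewrite mulr_ge0 ?envelope_ge0//=.
  by have := envelope_le T x (a0 k); lra.
- exact: cvg_cst.
- by rewrite -[X in _ --> X](mul0r (dotp x x)); apply: cvgM => //; exact: cvg_cst.
Qed.

(** For a fixed t the penalty |t|^2 / (2 (k + 1)) tends to 0, so the envelopes come arbitrarily
    close to <x, t>. Conversely the penalty is nonnegative, so each envelope is at most <x, p> for
    some p in T. *)
Lemma ereal_sup_envelope x :
  ereal_sup [set (dotp x t)%:E | t in T] =
  ereal_sup (range (fun k => (envelope T k.+1%:R x)%:E)).
Proof.
apply/eqP; rewrite eq_le; apply/andP; split.
  apply: ge_ereal_sup => _ [t Tt <-].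
  apply/lee_addgt0Pr => e e0.
  (* This k gives |t|^2 < (k + 1) e, so the penalty is below e. *)
  pose k := Num.truncn (dotp t t / e).
  apply: (@le_trans _ _ ((envelope T k.+1%:R x)%:E + e%:E)%E); last first.
    by rewrite leeD2r//; apply: ereal_sup_ubound; exists k.
  rewrite -EFinD lee_fin dotpC.
  have := envelope_max cT T0 x (ltr0Sn R k) Tt.
  suff h1 : dotp t t / (2 * k.+1%:R) <= e.
    by move=> h2; rewrite -lerBlDr; apply: le_trans h2; rewrite lerD2l lerN2.
  have k0 : 0 < k.+1%:R :> R by [].
  have /ltW : dotp t t / e < k.+1%:R by rewrite truncnS_gt.
  rewrite ler_pdivrMr// ler_pdivrMr ?mulr_gt0// => h.
  have : 0 <= k.+1%:R * e by rewrite mulr_ge0// ltW.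
  lra.
apply: ge_ereal_sup => _ [k _ <-].
apply: (@le_trans _ _ (dotp x (metric_proj T (k.+1%:R *: x)))%:E); last first.
  by apply: ereal_sup_ubound; exists (metric_proj T (k.+1%:R *: x)) => //; exact: metric_proj_in.
by rewrite lee_fin /envelope dotpC gerBl divr_ge0 ?sqr_proj_ge0// mulr_ge0.
Qed.

(** The integrals over ]0, k + 1] are twice the envelopes at k + 1, which increase to their
    supremum. *)
Lemma integral_density_infty x :
  (\int[lambda]_(nu in `]0%R, +oo[) (density x nu)%:E =
   2%:E * ereal_sup [set (dotp x t)%:E | t in T])%E.
Proof.
have -> : `]0%R, +oo[%classic = \bigcup_k `]0%R, k.+1%:R]%classic :> set R.
  apply/seteqP; split => [nu|nu [k _]] /=; last first.
    by rewrite !in_itv/= => /andP[->].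
  rewrite in_itv/= andbT => nu0; exists (Num.truncn nu) => //=.
  by rewrite in_itv/= nu0/= ltW// truncnS_gt.
have : (\int[lambda]_(nu in `]0%R, k.+1%:R]) (density x nu)%:E)%E @[k --> \oo] -->
    (\int[lambda]_(nu in \bigcup_k `]0%R, k.+1%:R]%classic) (density x nu)%:E)%E.
  apply: ge0_nondecreasing_set_cvg_integral => [j k jk|k|k|k nu _].
  - by rewrite subsetEset; apply: subset_itvl; rewrite bnd_simp ler_nat.
  - exact: measurable_itv.
  - apply/measurable_EFinP; apply: measurable_density; first exact: measurable_itv.
    by move=> nu /=; rewrite in_itv/= => /andP[].
  - by rewrite lee_fin density_ge0.
under eq_fun do rewrite integral_density// EFinM.
move=> /(cvg_lim (@ereal_hausdorff R)) <-; apply: (cvg_lim (@ereal_hausdorff R)).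
apply: cvgeZl => //; rewrite ereal_sup_envelope.
apply: ereal_nondecreasing_cvgn => j k jk; rewrite lee_fin.
by apply: envelope_ndecr; rewrite ?ler_nat.
Qed.

End radial_integral.

(** * Measurability and the exchange of integrals *)

Lemma continuous_measurable_borel_rV (R : realType) (n : nat) (f : 'rV[R]_n -> R) :
  continuous f -> measurable_fun [set: borel_rV R n] f.
Proof.
move=> /continuousP cf; apply: (measurability _ (RGenOpens.measurableE R)).
move=> _ [_ [a [b ->] <-]]; rewrite setTI.
by apply: sub_sigma_algebra; exact/cf/interval_open.
Qed.

Section joint_measurability.
Context {dO : measure_display} {Omega : measurableType dO} {R : realType}.
Context {P : probability Omega R} {n : nat} (xi : {RV P >-> borel_rV R n}).
Context (T : set 'rV[R]_n).
Local Notation lambda := (@lebesgue_measure R).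

Hypothesis cT : closed T.
Hypothesis convT : convex_set (T : set (convex_lmodType 'rV[R]_n)).
Hypothesis T0 : T 0.

Let pos : set (R * Omega) := `]0%R, +oo[ `*` [set: Omega].

Lemma measurable_sqr_proj_RV nu :
  measurable_fun [set: Omega] (fun w => sqr_proj T nu (xi w)).
Proof.
apply: (measurableT_comp (continuous_measurable_borel_rV _) (measurable_funPT xi)).
exact: sqr_proj_continuous.
Qed.

(* On nu > 0, sqr_proj is nondecreasing and continuous in nu, so that
   a < sqr_proj nu x iff a < sqr_proj q x for some rational 0 < q < nu. *)
Lemma measurable_sqr_proj_joint :
  measurable_fun pos (fun z => sqr_proj T z.1 (xi z.2)).
Proof.
move=> mpos; apply: (measurability _ (RGenOInfty.measurableE R)) => //.
move=> _ [_ [a ->] <-].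
(* Nonpositive rationals contribute the empty set, so the union can range over all of [rat]. *)
pose B (q : rat) : set (R * Omega) := if 0 < ratr q :> R
  then `]ratr q, +oo[ `*` [set w | a < sqr_proj T (ratr q) (xi w)] else set0.
have -> : pos `&` (fun z => sqr_proj T z.1 (xi z.2)) @^-1` `]a, +oo[ = \bigcup_q B q.
  apply/seteqP; split => [[nu w]|[nu w] [q _]]; rewrite /pos /B /= !in_itv/= !andbT.
    move=> [[nu0 _] anu].
    have /nbhs_ballP[e /= e0 he] : nbhs nu [set mu | a < sqr_proj T mu (xi w)].
      exact: (cvgr_gt _ (@sqr_proj_continuousl _ _ _ cT convT T0 (xi w) nu)).
    have [q] : exists q : rat, ratr q \in `]Num.max 0 (nu - e), nu[.
      by apply: rat_in_itvoo; rewrite gt_max nu0 ltrBlDr ltrDl.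
    rewrite in_itv/= gt_max => /andP[/andP[q0 qe] qnu].
    exists q => //; rewrite q0; split; rewrite /= ?in_itv/= ?qnu//.
    by apply: he; rewrite /ball/= gtr0_norm ?subr_gt0// ltrBlDl -ltrBlDr.
  case: ifPn => // q0 [/=]; rewrite in_itv/= andbT => qnu aq.
  split; first by split => //; exact: lt_trans qnu.
  by apply: lt_le_trans aq _; apply: sqr_proj_ndecr => //; exact: ltW.
apply: bigcupT_measurable_rat => q; rewrite /B; case: ifPn => // _.
apply: measurableX; first exact: measurable_itv.
have := measurable_sqr_proj_RV (ratr q) measurableT (measurable_itv `]a, +oo[).
by rewrite setTI preimage_itvoy.
Qed.

Lemma measurable_density_joint :
  measurable_fun pos (fun z => density T (xi z.2) z.1).
Proof.
(* For nu > 0 the inverse is the real power of exponent -1, which is measurable in nu. *)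
apply: (@eq_measurable_fun _ _ _ _ _
    (fun z => sqr_proj T z.1 (xi z.2) * (z.1 `^ (-1)) ^+ 2)).
  move=> [nu w]; rewrite inE => -[/=]; rewrite in_itv/= andbT => nu0 _.
  by rewrite powR_inv1// ltW.
apply: measurable_funM; first exact: measurable_sqr_proj_joint.
apply: measurable_funX; apply: measurable_funTS.
exact: (measurableT_comp (measurable_powR _) measurable_fst).
Qed.

(** Extension by zero to the whole product space, the form in which Tonelli's theorem applies. *)
Let restricted (A : set R) : R * Omega -> \bar R :=
  (fun z => (density T (xi z.2) z.1)%:E) \_ (A `*` [set: Omega]).

Let restricted_ge0 A z : (0 <= restricted A z)%E.
Proof. by rewrite /restricted patchE; case: ifPn => // _; rewrite lee_fin density_ge0. Qed.

Let measurable_restricted (A : set R) : measurable A -> A `<=` `]0%R, +oo[ ->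
  measurable_fun setT (restricted A).
Proof.
move=> mA A0; apply/(measurable_restrictT _ _).1.
  exact: measurableX.
apply/measurable_EFinP; apply: measurable_funS measurable_density_joint.
  by apply: measurableX.
by move=> [nu w] [/= /A0].
Qed.

Let restrictedE A nu w :
  restricted A (nu, w) = ((fun nu => (density T (xi w) nu)%:E) \_ A) nu.
Proof.
rewrite /restricted !patchE; congr (if _ then _ else _).
by apply/idP/idP; rewrite !inE//= => -[].
Qed.

Lemma integral_density_swap (A : set R) : measurable A -> A `<=` `]0%R, +oo[ ->
  (\int[P]_w \int[lambda]_(nu in A) (density T (xi w) nu)%:E =
   \int[lambda]_(nu in A) \int[P]_w (density T (xi w) nu)%:E)%E.
Proof.
move=> mA A0.
transitivity (\int[P]_w \int[lambda]_nu restricted A (nu, w))%E.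
  apply: eq_integral => w _; rewrite integral_mkcond.
  by apply: eq_integral => nu _; rewrite restrictedE.
rewrite -(@fubini_tonelli _ _ _ _ _ lambda P)//; last exact: measurable_restricted.
rewrite [RHS]integral_mkcond; apply: eq_integral => nu _.
rewrite patchE; case: ifPn => nuA.
  by apply: eq_integral => w _; rewrite restrictedE patchE nuA.
by apply: integral0_eq => w _; rewrite restrictedE patchE (negbTE nuA).
Qed.

Lemma measurable_integral_density (A : set R) : measurable A -> A `<=` `]0%R, +oo[ ->
  measurable_fun [set: Omega]
    (fun w => (\int[lambda]_(nu in A) (density T (xi w) nu)%:E)%E).
Proof.
move=> mA A0.
have := @measurable_fun_fubini_tonelli_G _ _ _ _ _ lambda _ (measurable_restricted mA A0)
  (restricted_ge0 A).
apply: eq_measurable_fun => w _; rewrite /fubini_G [RHS]integral_mkcond.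
by apply: eq_integral => nu _; rewrite restrictedE.
Qed.

End joint_measurability.

(** * Averaging the pointwise identities over the law of xi *)

Theorem theorem2p2 (dO : measure_display) (Omega : measurableType dO)
    (R : realType) (P : probability Omega R) (d : nat)
    (xi : {RV P >-> borel_rV R d}) (T : set 'rV[R]_d) :
  closed T ->
  convex_set (T : set (convex_lmodType 'rV[R]_d)) ->
  T 0 ->
  (forall sigma : R, 0 < sigma ->
    width P xi T =
      (\int[P]_w ereal_sup
          [set (dotp t (xi w) - norm2 t ^+ 2 / (2 * sigma))%:E | t in T]
       + (2^-1)%:E *
         \int[lebesgue_measure]_(nu in `]sigma, +oo[)
           'E_P[fun w => (norm2 (metric_proj (setdiv T nu) (xi w)) ^+ 2)%R])%E) /\
  width P xi T =
    ((2^-1)%:E *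
      \int[lebesgue_measure]_(nu in `]0%R, +oo[)
        'E_P[fun w => (norm2 (metric_proj (setdiv T nu) (xi w)) ^+ 2)%R])%E.
Proof.
move=> cT convT T0.
pose I (A : set R) w := (\int[lebesgue_measure]_(nu in A) (density T (xi w) nu)%:E)%E.
have I0 A w : (0 <= I A w)%E.
  by apply: integral_ge0 => nu _; rewrite lee_fin density_ge0.
have half0 : (0 <= (2^-1)%:E :> \bar R)%E by rewrite lee_fin.
have halfK (y : \bar R) : ((2^-1)%:E * (2%:E * y) = y)%E.
  by rewrite muleA -EFinM mulVf// mul1e.
have sub_pos (s : R) : 0 <= s -> `]s, +oo[ `<=` `]0%R, +oo[.
  by move=> s0 nu /=; rewrite !in_itv/= !andbT; exact: le_lt_trans.
(* Allowing s = 0 serves both identities: s is sigma in the first and 0 in the second. *)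
have swap (s : R) : 0 <= s ->
    (\int[lebesgue_measure]_(nu in `]s, +oo[)
       'E_P[fun w => (norm2 (metric_proj (setdiv T nu) (xi w)) ^+ 2)%R] =
     \int[P]_w I `]s, +oo[%classic w)%E.
  move=> s0; rewrite integral_density_swap//; last exact: sub_pos.
  apply: eq_integral => nu; rewrite inE => /(sub_pos s s0)/=.
  rewrite in_itv/= andbT => nu0; rewrite unlock; apply: eq_integral => w _.
  by rewrite norm2_metric_proj_setdiv.
have mI (s : R) : 0 <= s -> measurable_fun setT (I `]s, +oo[%classic).
  by move=> s0; apply: measurable_integral_density => //; exact: sub_pos.
have widthE : width P xi T = (\int[P]_w ((2^-1)%:E * I `]0%R, +oo[%classic w))%E.
  by apply: eq_integral => w _; rewrite /I integral_density_infty// halfK.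
split=> [sigma sigma0|]; last first.
  by rewrite widthE swap// ge0_integralZl//; exact: mI.
have sub_sigma : `]0%R, sigma] `<=` `]0%R, +oo[.
  by move=> nu /=; rewrite !in_itv/= andbT => /andP[].
have envE w : (envelope T sigma (xi w))%:E = ((2^-1)%:E * I `]0%R, sigma]%classic w)%E.
  by rewrite /I integral_density// EFinM halfK.
(* Every term is now a P-integral of half of some I A, and the identity reduces to splitting ]0,
   +oo[ at sigma. *)
rewrite widthE swap ?ltW// -ge0_integralZl//; last exact/mI/ltW.
rewrite -ge0_integralD//.
- apply: eq_integral => w _; rewrite envelope_sup// envE -ge0_muleDr//.
  congr (_ * _)%E; rewrite /I -ge0_integral_setU//=.
  + by rewrite -itv_bndbnd_setU// bnd_simp ltW.
  + apply/measurable_EFinP; apply: measurable_density => //.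
      exact: measurableU.
    by move=> nu [/sub_sigma|/(sub_pos sigma (ltW sigma0))]; rewrite /= in_itv/= andbT.
  + by move=> nu _; rewrite lee_fin density_ge0.
  + by apply: lt_disjoint => a b; rewrite !in_itv/= andbT => /andP[_ /le_lt_trans]; apply.
- by move=> w _; rewrite envelope_sup// lee_fin envelope_ge0.
(* Measurability in w of the supremum is read off its expression as an integral over ]0, sigma]. *)
- rewrite (_ : (fun w => _) = (fun w => (2^-1)%:E * I `]0%R, sigma]%classic w)%E).
    by apply: measurable_funeM; exact: measurable_integral_density.
  by apply/funext => w; rewrite envelope_sup// envE.
- by move=> w _; rewrite mule_ge0.
- by apply: measurable_funeM; exact/mI/ltW.
Qed.
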